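(* Let $I=[a,b]\subset\mathbb{R}$, let $\varphi:I\to I$, and let $f:I\to(0,\infty)$ be a $\varphi$-quasi-convex function. Then: (i) if $\varphi$ is linear, then $f\circ\varphi$ is quasi-convex on $I$; (ii) if $f$ is increasing and $\varphi$ is convex, then $f\circ\varphi$ is quasi-convex on $I$.
   Context: A function $f:I\to(0,\infty)$ is $\varphi$-quasi-convex if $f(t\varphi(x)+(1-t)\varphi(y))\le\max\{f(\varphi(x)),f(\varphi(y))\}$ for all $x,y\in I$ and $t\in[0,1]$. A function $g$ on $I$ is quasi-convex if $g(\lambda x+(1-\lambda)y)\le\max\{g(x),g(y)\}$ for all $x,y\in I$, $\lambda\in[0,1]$. ''$\varphi$ is linear'' means $\varphi(\lambda x+(1-\lambda)y)=\lambda\varphi(x)+(1-\lambda)\varphi(y)$ for all $x,y\in I$, $\lambda\in[0,1]$. ''Increasing'' means $u\le v$ implies $f(u)\le f(v)$. *)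

(* Defs.v *)
From HB Require Import structures.
From mathcomp Require Import all_boot all_order all_algebra.
From mathcomp Require Import interval_inference.
From mathcomp Require Import boolp classical_sets functions set_interval reals convex.

Set Implicit Arguments.
Unset Strict Implicit.
Unset Printing Implicit Defensive.

Import Order.TTheory GRing.Theory Num.Theory.

Local Open Scope classical_set_scope.
Local Open Scope ring_scope.
Local Open Scope convex_scope.

(* A function on a set D of reals is a total function on R whose values outside
   D are never used: every definition below only evaluates it at points of D
   when D is convex (and phi maps D to itself).
   For t : {i01 R}, i.e. 0 <= t <= 1, the library's x <| t |> y is
   t * x + (1 - t) * y; the alias R^o carries this convex structure. *)

Definition quasi_convex (R : realType) (D : set R) (g : R -> R) :=
  forall t : {i01 R}, {in D &, forall x y : R^o,
    g (x <| t |> y) <= Num.max (g x) (g y)}.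

Definition phi_quasi_convex (R : realType) (D : set R) (phi f : R -> R) :=
  forall t : {i01 R}, {in D &, forall x y : R,
    f ((phi x : R^o) <| t |> phi y) <= Num.max (f (phi x)) (f (phi y))}.

(* "Linear" in the sense of preserving convex combinations, hence affine: no
   condition at 0, which need not belong to D. *)
Definition linear_on (R : realType) (D : set R) (phi : R -> R) :=
  forall t : {i01 R}, {in D &, forall x y : R^o,
    phi (x <| t |> y) = (phi x : R^o) <| t |> phi y}.

Definition increasing_on (R : realType) (D : set R) (f : R -> R) :=
  {in D &, {homo f : u v / u <= v}}.

(* Main.v *)
Require Import Defs.
From mathcomp Require Import all_boot all_order all_algebra.
From mathcomp Require Import interval_inference.
From mathcomp Require Import boolp classical_sets functions set_interval reals convex.

Local Open Scope classical_set_scope.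
Local Open Scope ring_scope.

Import Order.TTheory.

(** A linear [phi] carries a combination of [x], [y] to the same combination of [phi x], [phi y],
    which [f_qc] bounds. For convex [phi] this equality weakens to [<=], and monotonicity of [f]
    carries it through to the same bound. *)

Lemma conv_itv (R : realDomainType) (i : interval R) (t : {i01 R}) (x y : R) :
  x \in i -> y \in i -> @conv R R^o t x y \in i.
Proof.
wlog xy : t x y / x <= y => [hw xi yi|].
  have [xy|/ltW yx] := leP x y; first exact: hw.
  by rewrite convC; exact: hw.
(* With [x <= y] the combination lies in [[x, y]], contained in [i] whether its bounds are open,
   closed or infinite. *)
case: i => l u xi yi; apply: subitvP (@convR_itv R x y t xy).
by rewrite subitvE; case/andP: xi => -> _; case/andP: yi => _ ->.
Qed.

Theorem theorem9 (R : realType) (a b : R) (phi f : R -> R)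
    (phiI : set_fun `[a, b] `[a, b] phi)
    (f_gt0 : set_fun `[a, b] `]0, +oo[ f)
    (f_qc : phi_quasi_convex `[a, b] phi f) :
  (linear_on `[a, b] phi -> quasi_convex `[a, b] (f \o phi)) /\
  (increasing_on `[a, b] f -> @convex_function R R^o `[a, b] phi ->
   quasi_convex `[a, b] (f \o phi)).
Proof.
split=> [phi_lin t x y xI yI|f_incr phi_cvx t x y xI yI] /=.
  by rewrite phi_lin //; exact: f_qc.
have [xab yab] : x \in `[a, b] /\ y \in `[a, b] by split; apply: set_mem.
apply: le_trans (f_qc t x y xI yI); apply: f_incr (phi_cvx t x y xI yI).
(* [f] is monotone only on [[a, b]], so both compared points must lie there: the image of a
   combination, then the combination of images. *)
- by apply/mem_set/phiI/conv_itv.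
- by apply/mem_set/conv_itv; exact: phiI.
Qed.
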